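(* Let $k>0$ be a finite integer and let $\mathbf{d}=(d_1,\ldots,d_k)$ be a vector of $k$ nonnegative real numbers with $d_1<1$. Let $t_0$ be the smallest positive root of the equation $$\ln \frac{1-t}{1-d_1} + \sum_{j=2}^k d_j t^{j-1} = 0 .$$ Call $t_0$ simple if it is not a double root of this equation, i.e., if the derivative of the left-hand side with respect to $t$ is nonzero at $t_0$. If $t_0$ is simple, the probability that a random formula from $H^k_{n,\mathbf{d}}$ is satisfiable in the limit $n\to\infty$ is $$\Phi(\mathbf{d}) := \lim_{n\to\infty} \Pr\left[H^k_{n,\mathbf{d}} \text{ is satisfiable}\right] = \frac{1-t_0}{1-d_1} .$$
   Context: A Horn clause is a disjunction of literals of which at most one is positive; a Horn-SAT formula is a conjunction of Horn clauses. For a finite $k>0$ and a vector $\mathbf{d}$ of $k$ nonnegative real numbers $d_1,d_2,\ldots,d_k$ with $d_1<1$, the random Horn-SAT formula $H^k_{n,\mathbf{d}}$ on Boolean variables $x_1,\ldots,x_n$ is the conjunction of: (1) a single negative literal $\overline{x}_1$; (2) $d_1 n$ positive literals chosen uniformly without replacement from $x_2,\ldots,x_n$; and (3) for each $2\le j\le k$, $d_j n$ clauses chosen uniformly from the $j\binom{n}{j}$ possible Horn clauses with $j$ variables where one literal is positive.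
   Formalization: ''Smallest positive root'' is taken as the smallest nonnegative root: the same when d_1 > 0, but t_0 = 0 when d_1 = 0, where the claim as written fails (d = (0,2) has simple positive root about 0.797, yet every formula is satisfiable). *)

(* Defs.v *)
From mathcomp Require Import all_boot all_order all_algebra.
From mathcomp Require Import all_classical all_reals all_analysis.

Set Implicit Arguments.
Unset Strict Implicit.
Unset Printing Implicit Defensive.

Import Order.TTheory GRing.Theory Num.Theory.
Import numFieldNormedType.Exports.

Local Open Scope ring_scope.

(* The Boolean variable x_(i+1) is the index i : 'I_n; the literal (i, true)
   is x_(i+1) and the literal (i, false) is its negation. *)
Definition literal (n : nat) : finType := ('I_n * bool)%type.

Definition clause (n : nat) : finType := {set literal n}.

Definition pos_literals (n : nat) (c : clause n) : clause n :=
  [set l in c | l.2].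

Definition clause_vars (n : nat) (c : clause n) : {set 'I_n} :=
  [set l.1 | l in c].

Definition horn (n : nat) (c : clause n) : bool := (#|pos_literals c| <= 1)%N.

Definition clause_sat (n : nat) (v : {ffun 'I_n -> bool}) (c : clause n) : bool :=
  [exists l in c, v l.1 == l.2].

Definition satisfiable (n : nat) (F : seq (clause n)) : bool :=
  [exists v : {ffun 'I_n -> bool}, all (clause_sat v) F].

(* #|c| = #|clause_vars c| forbids a variable and its negation in one clause. *)
Definition definite_clauses (n j : nat) : {set clause n} :=
  [set c : clause n | [&& horn c, #|clause_vars c| == j, #|c| == j
                        & #|pos_literals c| == 1%N]].

Lemma card_definite_clauses (n j : nat) :
  #|definite_clauses n j| = (j * 'C(n, j))%N.
Proof.
pose P := [set p : {set 'I_n} * 'I_n | (p.2 \in p.1) && (#|p.1| == j)].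
pose g (p : {set 'I_n} * 'I_n) : clause n :=
  [set l : literal n | (l.1 \in p.1) && (l.2 == (l.1 == p.2))].
have gV (p : {set 'I_n} * 'I_n) : clause_vars (g p) = p.1.
  apply/setP => i; apply/imsetP/idP => [[l]|ip].
    by rewrite inE => /andP[lp _] ->.
  by exists (i, i == p.2) => //; rewrite inE /= ip eqxx.
have gP (p : {set 'I_n} * 'I_n) : p.2 \in p.1 ->
    pos_literals (g p) = [set (p.2, true)].
  move=> pp; apply/setP => -[i b]; rewrite !inE /= xpair_eqE.
  by case: (eqVneq i p.2) => [->|_]; case: b; rewrite ?pp ?andbF ?andbT.
have gC (p : {set 'I_n} * 'I_n) : #|g p| = #|p.1|.
  rewrite -[in RHS](gV p) /clause_vars card_in_imset // => -[i b] [i' b'].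
  by rewrite !inE /= => /andP[_ /eqP->] /andP[_ /eqP->] ->.
have ginj : {in P &, injective g}.
  move=> [V x] [W y]; rewrite !inE /= => /andP[Vx _] /andP[Wy _] e.
  have eV : V = W by have := congr1 (@clause_vars n) e; rewrite !gV.
  have := congr1 (@pos_literals n) e; rewrite !gP //= => /set1_inj[->].
  by rewrite eV.
have -> : definite_clauses n j = g @: P.
  apply/setP => c; apply/idP/imsetP => [|[p]]; last first.
    rewrite inE => /andP[pp /eqP pj] ->.
    by rewrite inE /horn gV gP // gC cards1 pj !eqxx.
  rewrite inE => /and4P[_ /eqP cv /eqP cj /cards1P[[x b] cx]].
  have xc : (x, b) \in pos_literals c by rewrite cx inE.
  move: (xc); rewrite inE /= => /andP[xbc bT].
  have inj : {in c &, injective (fst : literal n -> 'I_n)}.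
    by apply/imset_injP; rewrite -/(clause_vars c) cv cj.
  have xV : x \in clause_vars c by apply/imsetP; exists (x, b).
  exists (clause_vars c, x); first by rewrite inE /= xV cv eqxx.
  apply/setP => -[i b']; rewrite inE /=; apply/idP/andP.
    move=> ic; split; first by apply/imsetP; exists (i, b').
    case: b' ic => ic; last first.
      rewrite eq_sym; apply/eqP/eqP => ix; subst i.
      by have [] := inj _ _ ic xbc erefl => eb; rewrite -eb in bT.
    have : (i, true) \in pos_literals c by rewrite inE ic.
    by rewrite cx inE xpair_eqE => /andP[->].
  move=> [/imsetP[[i' b''] ic /= ->] /eqP->].
  case: (eqVneq i' x) => [ix|ix]; first by rewrite ix -bT.
  case: b'' ic => // ic.
  have : (i', true) \in pos_literals c by rewrite inE ic.
  by rewrite cx inE xpair_eqE (negbTE ix).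
rewrite card_in_imset //.
rewrite -sum1_card (eq_bigl (fun p : {set 'I_n} * 'I_n =>
  (#|p.1| == j) && (p.2 \in p.1))); last by move=> p; rewrite inE andbC.
rewrite -(pair_big_dep (fun V : {set 'I_n} => #|V| == j)
  (fun V x => x \in V) (fun _ _ => 1%N)) /=.
rewrite (eq_bigr (fun=> j)); last by move=> V /eqP <-; rewrite sum1_card.
by rewrite sum_nat_const -[in LHS]cardsE card_draws card_ord mulnC.
Qed.

Section Model.
Variables (R : realType) (k : nat) (d : k.-tuple R).

(* Coordinates are numbered from 1, as d_1, ..., d_k. *)
Definition dcoef (j : nat) : R := d`_(j.-1).

(* The integer part of d_j n. *)
Definition num_clauses (n j : nat) : nat := Num.truncn (dcoef j * n%:R).

(* One slot for each of the clauses of width i + 2 = 2, ..., k. *)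
Definition slot (n : nat) : finType :=
  {i : 'I_k.-1 & 'I_(num_clauses n i.+2)}.

Definition slot_width (n : nat) (s : slot n) : nat := (tag s).+2.

(* The outcomes of the random choices: the set of variables of the positive
   unit clauses, drawn without replacement among x_2, ..., x_n, and the clauses
   filling the slots, drawn independently (that is, with replacement). *)
Definition outcomes (n : nat) :
    {set {set 'I_n} * {ffun slot n -> clause n}} :=
  [set w : {set 'I_n} * {ffun slot n -> clause n} |
     [&& #|w.1| == num_clauses n 1,
         [forall i in w.1, val i != 0%N]
       & [forall s, w.2 s \in definite_clauses n (slot_width s)]]].

(* The clause whose only literal is the negation of x_1, for 0 < n. *)
Definition neg_x1 (n : nat) : clause n :=
  [set l : literal n | (val l.1 == 0%N) && ~~ l.2].

Definition formula (n : nat) (w : {set 'I_n} * {ffun slot n -> clause n}) :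
    seq (clause n) :=
  neg_x1 n :: [seq [set (i, true)] | i in w.1] ++ [seq w.2 s | s : slot n].

(* The probability that H^k_{n,d} is satisfiable, for outcomes uniformly
   distributed; it has a meaning as soon as k <= n and 0 < n. *)
Definition sat_prob (n : nat) : R :=
  #|[set w in outcomes n | satisfiable (formula w)]|%:R / #|outcomes n|%:R.

Definition root_fun (t : R) : R :=
  ln ((1 - t) / (1 - dcoef 1)) + \sum_(2 <= j < k.+1) dcoef j * t ^+ j.-1.

(* The condition t < 1 is the domain of the logarithm, since [ln] is 0 on
   nonpositive numbers. *)
Definition is_root (t : R) : Prop := t < 1 /\ root_fun t = 0.

(* The root t = 0 is allowed. If d_1 > 0 it does not occur and this is the
   smallest positive root. If d_1 = 0, no positive literal is drawn, every
   formula is satisfiable, and the root that gives the probability 1 is 0, even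
   when the equation also has a positive root (as for d = (0, 2)). *)
Definition smallest_root (t0 : R) : Prop :=
  [/\ 0 <= t0, is_root t0 & forall t, 0 <= t -> is_root t -> t0 <= t].

Definition simple_root (t0 : R) : Prop := derive1 root_fun t0 != 0.

End Model.

(* Main.v *)
Require Import Defs.
From mathcomp Require Import all_boot all_order all_algebra.
From mathcomp Require Import fingroup perm ring lra.
From mathcomp Require Import all_classical all_reals all_analysis.

Set Implicit Arguments.
Unset Strict Implicit.
Unset Printing Implicit Defensive.

Import Order.TTheory GRing.Theory Num.Theory.
Import numFieldNormedType.Exports.

(* Write [consequences U f] for the set of variables forced to be true by the
   units [U] and the definite clauses [f]; the formula is satisfiable iff x_1 is
   not forced.  By symmetry between the variables, the probability of this is the
   mean of n - |consequences U f|, divided by n - |U|, so it suffices to show that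
   |consequences U f| / n tends to t_0 in probability.

   Draw the head of each clause independently of its body (the heads that fall
   in their own body are a constant-factor nuisance).  Run unit propagation one
   variable at a time and rename each variable to the time of its exploration:
   this is a bijection of the sample space, after which |consequences| is the first
   time t such that at most t variables are units or heads of clauses whose body
   lies in [0, t).  For t = z n the fraction of the other variables has mean
   tending to (1 - d_1) exp(- sum_j d_j z^(j-1)) and variance at most 1/n.  This
   limit is less than 1 - z on [0, t_0), and larger than 1 - z at points
   arbitrarily close to t_0 on its right because t_0 is simple; Chebyshev's
   inequality on a finite grid of times concludes.  (This is for d_1 > 0; if d_1 = 0
   there are no consequences at all and t_0 = 0.) *)

(** * Unit propagation and the exploration relabelling *)

Section Propagation.
Import mathcomp.boot.fintype mathcomp.boot.finset.

Variables (n : nat) (S : finType).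
Implicit Types (U P N : {set 'I_n}) (f g : {ffun S -> 'I_n * {set 'I_n}}).

(* [f s = (h, B)] stands for the definite clause with head [h] and body [B]. *)
Definition propagate U f P : {set 'I_n} :=
  U :|: [set (f s).1 | s : S & (f s).2 \subset P].

Definition stable_set U f P := propagate U f P \subset P.

Definition consequences U f : {set 'I_n} := \bigcap_(P | stable_set U f P) P.

Lemma propagateS U f P P' : P \subset P' -> propagate U f P \subset propagate U f P'.
Proof.
move=> sPP'; apply/setUS/subsetP => x /imsetP[s].
rewrite inE => sP ->; apply/imsetP; exists s => //.
by rewrite inE (subset_trans sP).
Qed.

Lemma consequences_min U f P : stable_set U f P -> consequences U f \subset P.
Proof. by move=> sP; apply: (bigcap_inf P). Qed.

Lemma consequences_stable U f : stable_set U f (consequences U f).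
Proof.
apply/bigcapsP => P sP; apply: subset_trans (sP).
exact: (propagateS _ _ (consequences_min sP)).
Qed.

Lemma sub_consequences U f : U \subset consequences U f.
Proof. exact: subset_trans (subsetUl _ _) (consequences_stable U f). Qed.

Lemma notin_consequencesP U f x :
  reflect (exists2 P, stable_set U f P & x \notin P) (x \notin consequences U f).
Proof.
apply: (iffP idP) => [xC|[P sP]].
  by exists (consequences U f); first exact: consequences_stable.
exact/contra/(subsetP (consequences_min sP)).
Qed.

(** * Exploration of the variables one at a time *)

Variable i0 : 'I_n.

(* The default value [i0] is returned only if [P] contains everything. *)
Definition next N P : 'I_n :=
  odflt (odflt i0 [pick x in ~: P]) [pick x in N :\: P].

(** When [N_ t] offers nothing new, [next] takes any unexplored variable: the exploration outlives
    propagation, and in [n] steps visits every variable once. *)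
Fixpoint explored (N_ : nat -> {set 'I_n}) (t : nat) : {set 'I_n} :=
  if t is t'.+1 then next (N_ t') (explored N_ t') |: explored N_ t' else set0.

Definition visit (N_ : nat -> {set 'I_n}) (t : nat) := next (N_ t) (explored N_ t).

Lemma next_notin N P : (#|P| < n)%N -> next N P \notin P.
Proof.
move=> Pn; rewrite /next; case: (pickP [in N :\: P]) => [x|_] /=.
  by rewrite inE => /andP[].
case: (pickP [in ~: P]) => [x|Pall] /=; first by rewrite inE.
suff PT : P = setT by move: Pn; rewrite PT cardsT card_ord ltnn.
by apply/setP => x; have := Pall x; rewrite !inE => /negbFE.
Qed.

Lemma next_mem N P : ~~ (N \subset P) -> next N P \in N.
Proof.
move=> /subsetPn[x xN xP]; rewrite /next; case: (pickP [in N :\: P]) => [y|/(_ x)] /=.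
  by rewrite inE => /andP[].
by rewrite inE xP xN.
Qed.

Section Explored.
Variable N_ : nat -> {set 'I_n}.

Lemma explored_visit t : explored N_ t.+1 = visit N_ t |: explored N_ t.
Proof. by []. Qed.

Lemma card_explored t : (t <= n)%N -> #|explored N_ t| = t.
Proof.
elim: t => [|t IH] tn; first by rewrite cards0.
by rewrite explored_visit cardsU1 IH ?(ltnW tn) // next_notin ?IH ?(ltnW tn).
Qed.

Lemma explored_mono t t' : (t <= t')%N -> explored N_ t \subset explored N_ t'.
Proof.
elim: t' => [|t' IH]; first by rewrite leqn0 => /eqP ->.
rewrite leq_eqVlt => /orP[/eqP -> //|/IH s].
by rewrite explored_visit (subset_trans s) ?subsetUr.
Qed.

Lemma mem_visit_explored c t : (c < n)%N -> (visit N_ c \in explored N_ t) = (c < t)%N.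
Proof.
move=> cn; case: ltnP => [ct|tc].
  by apply: (subsetP (explored_mono ct)); rewrite explored_visit setU11.
apply/negP => /(subsetP (explored_mono tc)).
by apply/negP; rewrite next_notin // card_explored // ltnW.
Qed.

Lemma visit_inj : injective (fun i : 'I_n => visit N_ i).
Proof.
suff lt_neq (i j : 'I_n) : (i < j)%N -> visit N_ i != visit N_ j.
  move=> i j /eqP e; apply/val_inj/eqP; case: ltngtP => // [/lt_neq|/lt_neq].
    by rewrite e.
  by rewrite eq_sym e.
move=> ij; apply/eqP => e.
have := mem_visit_explored j (ltn_ord i).
by rewrite e mem_visit_explored // ltnn ij.
Qed.

(** Turns inclusion of a renamed body into a comparison of times, from which the visiting order has
    disappeared. *)
Lemma visit_imset_sub t (B : {set 'I_n}) :
  ([set visit N_ c | c : 'I_n in B] \subset explored N_ t)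
    = (B \subset [set c : 'I_n | c < t]%N).
Proof.
apply/subsetP/subsetP => sB => [c cB|x /imsetP[c cB ->]].
  by rewrite inE -mem_visit_explored //; apply/sB/imset_f.
by rewrite mem_visit_explored //; have := sB _ cB; rewrite inE.
Qed.

End Explored.

(** The bodies of [f] are read as sets of times, so no exploration is involved and the law of this
    set is computed directly. *)
Definition reached U f (t : nat) : {set 'I_n} :=
  propagate U f [set c : 'I_n | (c < t)%N].

(* Deferred decisions: in [f] the bodies consist of exploration times, and time
   [c] is replaced by the variable explored at that time.  The relabelling is
   a bijection because the exploration can be replayed from [relabel U f]. *)
Definition relabel U f : {ffun S -> 'I_n * {set 'I_n}} :=
  [ffun s => ((f s).1, [set visit (reached U f) c | c : 'I_n in (f s).2])].

Lemma propagate_relabel U f t :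
  propagate U (relabel U f) (explored (reached U f) t) = reached U f t.
Proof.
congr (_ :|: _); apply/setP => x; apply/imsetP/imsetP => -[s];
  rewrite inE => sP ->; exists s; rewrite ?inE ?ffunE //=.
  by move: sP; rewrite ffunE /= visit_imset_sub.
by rewrite visit_imset_sub.
Qed.

Lemma relabel_inj U : injective (relabel U).
Proof.
move=> f g fg.
(* The next variable depends only on the explored set and on [reached] at that time, which the
   relabelled system determines; so both explorations agree step by step. *)
have ex t : explored (reached U f) t = explored (reached U g) t.
  elim: t => [//|t IH]; rewrite /= -!propagate_relabel.
  by rewrite fg IH.
have vi t : visit (reached U f) t = visit (reached U g) t.
  by rewrite /visit -!propagate_relabel ex fg.
apply/ffunP => s; have := congr1 (fun h : {ffun _ -> _} => h s) fg.
rewrite !ffunE => -[h1]; under eq_imset do rewrite vi.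
move/(imset_inj (@visit_inj _)) => h2.
by rewrite [LHS]surjective_pairing h1 h2 -surjective_pairing.
Qed.

Lemma card_relabel_body U f s : #|(relabel U f s).2| = #|(f s).2|.
Proof. by rewrite ffunE /= card_imset //; exact: visit_inj. Qed.

Lemma reached_sub U f t t' : (t <= t')%N -> reached U f t \subset reached U f t'.
Proof.
by move=> tt'; apply/propagateS/subsetP => c; rewrite !inE => /leq_trans ->.
Qed.

(** At the least [u] with at most [u] variables reached, the explored set equals the reached one,
    hence is stable. *)
Lemma consequences_relabel_le U f t : (t <= n)%N -> (#|reached U f t| <= t)%N ->
  (#|consequences U (relabel U f)| <= t)%N.
Proof.
move=> tn rt; case: (ex_minnP (ex_intro (fun u => #|reached U f u| <= u)%N t rt)).
move=> u ru umin; have ut := umin _ rt; have un := leq_trans ut tn.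
have sub v : (v <= u)%N -> explored (reached U f) v \subset reached U f u.
  elim: v => [|v IH] vu; first exact: sub0set.
  rewrite explored_visit subUset IH ?(ltnW vu) // andbT sub1set.
  apply: (subsetP (reached_sub U f (ltnW vu))); apply: next_mem.
  (* By minimality of [u], more than [v] variables are reached at time [v < u], so some reached one
     is unexplored. *)
  apply: contraTN (vu) => /subset_leq_card.
  rewrite card_explored; last exact: leq_trans (ltnW vu) un.
  by move/umin; rewrite -leqNgt.
have eP : explored (reached U f) u = reached U f u.
  by apply/eqP; rewrite eqEcard sub // card_explored.
apply: leq_trans ut; rewrite -[leqRHS](card_explored (reached U f) un).
apply/subset_leq_card/consequences_min.
by rewrite /stable_set propagate_relabel eP.
Qed.

(** As long as more than [u] variables are reached at time [u], the next one is picked among them,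
    and they follow from those already explored. *)
Lemma consequences_relabel_ge U f t : (t <= n)%N ->
  (forall u, (u < t)%N -> (u < #|reached U f u|)%N) ->
  (t <= #|consequences U (relabel U f)|)%N.
Proof.
move=> tn rt; rewrite -[leqLHS](card_explored (reached U f) tn).
apply: subset_leq_card; elim: t tn rt => [|t IH] tn rt; first exact: sub0set.
have sC : explored (reached U f) t \subset consequences U (relabel U f).
  by apply: IH (ltnW tn) _ => u ut; apply: rt; apply: leq_trans ut _.
rewrite explored_visit subUset sC andbT sub1set.
apply: (subsetP (consequences_stable U (relabel U f))).
apply: (subsetP (propagateS U (relabel U f) sC)).
rewrite propagate_relabel; apply: next_mem.
apply/negP => /subset_leq_card; rewrite card_explored ?(ltnW tn) //.
by rewrite leqNgt rt.
Qed.

Lemma card_relabel_preim U (A : {set {ffun S -> 'I_n * {set 'I_n}}}) :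
  #|[set f | relabel U f \in A]| = #|A|.
Proof.
rewrite -[RHS](card_preimset _ (@relabel_inj U)).
by apply: eq_card => f; rewrite !inE.
Qed.

End Propagation.

(** * Variance of the number of unreached variables *)

Section Counting.
Import mathcomp.boot.fintype mathcomp.boot.finset.

Variables (n : nat) (S : finType) (q : S -> nat).
Implicit Types (U D Y : {set 'I_n}) (f : {ffun S -> 'I_n * {set 'I_n}}).

(** Head and body are independent, and a head may lie in its own body; this makes the counts exact
    products over the slots. *)
Definition systems : {set {ffun S -> 'I_n * {set 'I_n}}} :=
  [set f : {ffun S -> 'I_n * {set 'I_n}} | [forall s, #|(f s).2| == q s]].

Lemma relabel_systems (i0 : 'I_n) U f : (relabel i0 U f \in systems) = (f \in systems).
Proof. by rewrite !inE; apply: eq_forallb => s; rewrite card_relabel_body. Qed.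

Lemma card_relabel_systems (i0 : 'I_n) U (P : pred {ffun S -> 'I_n * {set 'I_n}}) :
  #|[set f in systems | P (relabel i0 U f)]| = #|[set f in systems | P f]|.
Proof.
rewrite -[RHS](card_relabel_preim i0 U); apply: eq_card => f.
by rewrite [RHS]in_set; apply/setIdP/setIdP; rewrite relabel_systems.
Qed.

Lemma card_systems_avoid Y D :
  #|[set f in systems | [forall s, ((f s).1 \in Y) ==> ~~ ((f s).2 \subset D)]]|
    = (\prod_s (n * 'C(n, q s) - #|Y| * 'C(#|D|, q s)))%N.
Proof.
pose F s := [set p : 'I_n * {set 'I_n} | (#|p.2| == q s) &&
  ((p.1 \in Y) ==> ~~ (p.2 \subset D))].
have -> : [set f in systems | [forall s, ((f s).1 \in Y) ==> ~~ ((f s).2 \subset D)]]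
    = [set f in family F].
  apply/setP => f; rewrite !inE; apply/andP/familyP => [[/forallP h1 /forallP h2] s|h].
    by rewrite inE h1 h2.
  by split; apply/forallP => s; have := h s; rewrite inE => /andP[].
rewrite cardsE card_family foldrE big_map big_enum /=.
apply: eq_bigr => s _.
pose A := [set B : {set 'I_n} | #|B| == q s].
pose A' := [set B : {set 'I_n} | B \subset D & #|B| == q s].
have -> : #|F s| = #|setX [set: 'I_n] A :\: setX Y A'|.
  apply: eq_card => -[h B]; rewrite !inE /=.
  by case: (h \in Y); case: (B \subset D); case: (#|B| == q s).
rewrite cardsD (setIidPr _); last first.
  by apply/subsetP => -[h B]; rewrite !inE /= => /and3P[].
by rewrite !cardsX cardsT card_ord card_draws card_ord cards_draws.
Qed.

Lemma card_systems : #|systems| = (\prod_s (n * 'C(n, q s)))%N.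
Proof.
have := card_systems_avoid set0 set0; rewrite cards0.
under eq_bigr do rewrite mul0n subn0.
move=> <-; apply: eq_card => f; rewrite [RHS]inE andb_idr // => _.
by apply/forallP => s; rewrite inE.
Qed.

Lemma notin_reached U f t y : (y \notin reached U f t) = (y \notin U) &&
  [forall s, ((f s).1 \in [set y]) ==> ~~ ((f s).2 \subset [set c : 'I_n | (c < t)%N])].
Proof.
rewrite inE negb_or; congr (_ && _); apply/idP/forallP => [yr s|h].
  rewrite inE; apply/implyP => /eqP fy; apply: contra yr => sD.
  by apply/imsetP; exists s; rewrite ?inE.
apply/imsetP => -[s]; rewrite inE => sD ys; have := h s.
by rewrite sD inE ys eqxx.
Qed.

Lemma card_ltn_ord t : (t <= n)%N -> #|[set c : 'I_n | (c < t)%N]| = t.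
Proof.
move=> tn; rewrite -sum1dep_card -(big_ord_widen _ (fun=> 1%N)) //.
by rewrite sum1_card card_ord.
Qed.

Variable (R : realType).
Local Open Scope ring_scope.

(** The probability that no clause has its head in a given set of [k] variables and its body in
    [[0, t)]. *)
Definition miss_prob (k t : nat) : R :=
  \prod_s (1 - k%:R * ('C(t, q s)%:R / 'C(n, q s)%:R) / n%:R).

Hypothesis q_le : forall s, (q s <= n)%N.

Lemma card_systems_gt0 : (0 < n)%N -> (0 < #|systems|)%N.
Proof.
move=> n0; rewrite card_systems; apply: prodn_gt0 => s.
by rewrite muln_gt0 n0 bin_gt0 q_le.
Qed.

Lemma card_systems_miss Y t : (0 < n)%N -> (t <= n)%N ->
  #|[set f in systems | [forall s, ((f s).1 \in Y) ==>
      ~~ ((f s).2 \subset [set c : 'I_n | (c < t)%N])]]|%:R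
    = miss_prob #|Y| t * #|systems|%:R.
Proof.
move=> n0 tn; rewrite card_systems_avoid card_systems card_ltn_ord // !natr_prod.
rewrite -big_split /=; apply: eq_bigr => s _; rewrite natrB; last first.
  apply: leq_mul; first by rewrite -[leqRHS]card_ord max_card.
  exact: leq_bin2l.
have C0 : 'C(n, q s)%:R != 0 :> R by rewrite pnatr_eq0 -lt0n bin_gt0 q_le.
have n0' : n%:R != 0 :> R by rewrite pnatr_eq0 -lt0n.
by rewrite !natrM mulrBl mul1r; congr (_ - _); field; rewrite C0 n0'.
Qed.

(** Negative correlation, slot by slot: [1 - 2 * y <= (1 - y) ^+ 2]. The bound [2 <= n] keeps the
    left factors nonnegative, as comparing products requires. *)
Lemma miss_prob2_le t : (2 <= n)%N -> (t <= n)%N -> miss_prob 2 t <= miss_prob 1 t ^+ 2.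
Proof.
move=> n2 tn; rewrite expr2 -big_split /=; apply: ler_prod => s _.
set x : R := 'C(t, q s)%:R / _; have x1 : x <= 1.
  rewrite ler_pdivrMr ?ltr0n ?bin_gt0 ?q_le // mul1r ler_nat.
  exact: leq_bin2l.
have n2' : 2 <= n%:R :> R by rewrite ler_nat.
have n0 : 0 < n%:R :> R by lra.
apply/andP; split.
  rewrite subr_ge0 ler_pdivrMr // mul1r; lra.
rewrite -subr_ge0; set y := x / n%:R.
have -> : (1 - 1 * x / n%:R) * (1 - 1 * x / n%:R) - (1 - 2 * x / n%:R) = y ^+ 2.
  by rewrite /y; field; rewrite gt_eqF.
exact: sqr_ge0.
Qed.

Lemma notin_reached2 U f t y z : y \notin U -> z \notin U ->
  (y \notin reached U f t) && (z \notin reached U f t) =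
  [forall s, ((f s).1 \in [set y; z]) ==>
    ~~ ((f s).2 \subset [set c : 'I_n | (c < t)%N])].
Proof.
move=> yU zU; rewrite !notin_reached yU zU /=.
apply/andP/forallP => [[/forallP hy /forallP hz] s|h].
  have := hy s; have := hz s; rewrite !inE.
  by do 2!case: eqP => //=.
by split; apply/forallP => s; have := h s; rewrite !inE;
  do 2!case: eqP => //=.
Qed.

(** The count is a sum of indicators over the complement of [U]. Covariances are nonpositive, so
    only the diagonal, at most [n] terms, contributes. *)
Lemma reached_variance U t (mu := (n - #|U|)%:R * miss_prob 1 t) :
  (2 <= n)%N -> (t <= n)%N ->
  \sum_(f in systems) (#|~: reached U f t|%:R - mu) ^+ 2 <= n%:R * #|systems|%:R.
Proof.
move=> n2 tn; have n0 : (0 < n)%N by apply: leq_trans n2.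
set T : R := #|systems|%:R; set p := miss_prob 1 t in mu *.
set v : R := (n - #|U|)%:R in mu *.
pose b f y : R := (y \notin reached U f t)%:R.
have Xb f : #|~: reached U f t|%:R = \sum_(y in ~: U) b f y.
  rewrite -sum1_card natr_sum /b big_mkcond [RHS]big_mkcond /=.
  apply: eq_bigr => y _; rewrite !in_setC notin_reached.
  by case: (y \in U) => //=; case: ifP.
have cU : #|~: U|%:R = v :> R by rewrite cardsCs setCK card_ord.
have sumb y z : y \notin U -> z \notin U ->
    \sum_(f in systems) b f y * b f z = miss_prob #|[set y; z]| t * T.
  move=> yU zU; rewrite -card_systems_miss // -sum1_card natr_sum.
  rewrite big_mkcond [RHS]big_mkcond /=; apply: eq_bigr => f _.
  rewrite [in RHS]inE -(notin_reached2 f t yU zU) /b -natrM mulnb.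
  by case: (f \in systems) => //=; case: (_ && _).
have sumX : \sum_(f in systems) #|~: reached U f t|%:R = mu * T.
  under eq_bigr do rewrite Xb; rewrite exchange_big /=.
  rewrite (eq_bigr (fun=> p * T)) => [|y].
    by rewrite sumr_const -mulr_natl cU mulrA.
  rewrite inE => yU; have := sumb y y yU yU; rewrite setUid cards1 => <-.
  by apply: eq_bigr => f _; rewrite /b -natrM mulnb andbb.
have sumX2 : \sum_(f in systems) #|~: reached U f t|%:R ^+ 2 <= v * T + mu ^+ 2 * T.
  under eq_bigr do rewrite Xb expr2 big_distrlr /=.
  rewrite exchange_big /=; under eq_bigr do rewrite exchange_big /=.
  (* Off the diagonal the probability is at most [p ^+ 2], on it at most 1. Keeping [p ^+ 2] on the
     diagonal too makes the second part sum to [mu ^+ 2 * T]. *)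
  apply: le_trans (_ : \sum_(y in ~: U) \sum_(z in ~: U)
      ((z == y)%:R * T + p ^+ 2 * T) <= _).
    apply: ler_sum => y; rewrite inE => yU; apply: ler_sum => z; rewrite inE => zU.
    rewrite sumb // cards2 eq_sym; case: eqP => _ /=; rewrite ?mul0r ?add0r ?mul1r.
      apply: le_trans (_ : T <= _); last by rewrite lerDl mulr_ge0 // sqr_ge0.
      rewrite -(cards1 y) -card_systems_miss // ler_nat.
      by apply/subset_leq_card/subsetP => f; rewrite inE => /andP[].
    by rewrite ler_wpM2r // miss_prob2_le.
  under eq_bigr do rewrite big_split /= sumr_const -mulr_natl cU.
  rewrite big_split /= sumr_const -mulr_natl cU lerD //; last first.
    by rewrite /mu exprMn expr2 !mulrA.
  rewrite -cU -sum1_card natr_sum mulr_suml; apply: ler_sum => y yU.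
  rewrite -mulr_suml mul1r -[leRHS]mul1r ler_wpM2r //.
  rewrite (bigD1 y) //= eqxx big1 ?addr0 // => z /andP[_ /negbTE ->] //.
under eq_bigr do rewrite sqrrB; rewrite !big_split /= sumrN.
rewrite sumrMnl -mulr_suml sumX sumr_const -mulr_natr -/T.
have vn : v * T <= n%:R * T by rewrite ler_wpM2r // ler_nat leq_subr.
move: sumX2; lra.
Qed.

(** Chebyshev's inequality in counting form. *)
Lemma card_deviation (T : finType) (E : {set T}) (X : T -> R) (mu c : R) : 0 <= c ->
  c ^+ 2 * #|[set x in E | c <= `|X x - mu|]|%:R <= \sum_(x in E) (X x - mu) ^+ 2.
Proof.
move=> c0; rewrite -sum1_card natr_sum mulr_sumr big_mkcond [leRHS]big_mkcond /=.
apply: ler_sum => x _; rewrite inE; case: (x \in E) => //=.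
case: ifP => [cx|_]; last exact: sqr_ge0.
by rewrite mulr1 -[leRHS]real_normK ?num_real // lerXn2r ?nnegrE.
Qed.

End Counting.

(** * Elementary limits *)

Section Limits.
Variable R : realType.
Local Open Scope classical_set_scope.
Local Open Scope ring_scope.

Lemma cvg_natV : (n%:R^-1 : R) @[n --> \oo] --> (0 : R).
Proof.
apply/cvgrPdist_le => e e0; near=> n.
rewrite sub0r normrN ger0_norm ?invr_ge0 // -[leRHS]invrK lef_pV2 ?qualifE /=.
- by near: n; exact: nbhs_infty_ger.
- by rewrite ltr0n; near: n; exact: nbhs_infty_gt.
- by rewrite invr_gt0.
Unshelve. all: by end_near. Qed.

Lemma cvg_truncn_ratio (z : R) : 0 <= z ->
  (Num.truncn (z * n%:R))%:R / n%:R @[n --> \oo] --> z.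
Proof.
move=> z0; apply: (@squeeze_cvgr _ _ _ _ (fun n => z - n%:R^-1) (fun=> z)).
- near=> n; have n0 : 0 < n%:R :> R.
    by rewrite ltr0n; near: n; exact: nbhs_infty_gt.
  have /andP[h1 h2] := truncn_itv (mulr_ge0 z0 (ltW n0)).
  rewrite ler_pdivrMr // h1 andbT ler_pdivlMr // mulrBl mulVf ?gt_eqF //.
  by rewrite lerBlDr natr1 ltW.
- rewrite -[X in _ --> X]subr0; apply: cvgB; [exact: cvg_cst|exact: cvg_natV].
- exact: cvg_cst.
Unshelve. all: by end_near. Qed.

Lemma cvg_subn_ratio (t : nat -> nat) (z : R) q :
  (t n)%:R / n%:R @[n --> \oo] --> z ->
  (t n - q)%N%:R / n%:R @[n --> \oo] --> z.
Proof.
move=> tz.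
apply: (@squeeze_cvgr _ _ _ _ (fun n => (t n)%:R / n%:R - q%:R * n%:R^-1)
  (fun n => (t n)%:R / n%:R)) => //.
- near=> n; rewrite -mulrBl !ler_wpM2r ?invr_ge0 ?ler_nat ?leq_subr //.
  by rewrite lerBlDr -natrD ler_nat addnC -leq_subLR.
- rewrite -[X in _ --> X]subr0 -(mulr0 q%:R).
  by apply: cvgB => //; apply: cvgM; [exact: cvg_cst|exact: cvg_natV].
Unshelve. all: by end_near. Qed.

(** With falling factorials, each increment of the exponent multiplies the ratio by
    [(t n - p) / (n - p)], which tends to [z]. *)
Lemma cvg_bin_ratio (t : nat -> nat) (z : R) q :
  (t n)%:R / n%:R @[n --> \oo] --> z ->
  'C(t n, q)%:R / 'C(n, q)%:R @[n --> \oo] --> z ^+ q.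
Proof.
move=> tz.
have ffE p : (fun n => 'C(t n, p)%:R / 'C(n, p)%:R) =
    (fun n => (t n ^_ p)%:R / (n ^_ p)%:R) :> (nat -> R).
  apply/funext => n; rewrite -!bin_ffact !natrM -mulf_div [p`!%:R / _]divff ?mulr1 //.
rewrite ffE {ffE}.
suff step p : (t n ^_ p)%:R / (n ^_ p)%:R @[n --> \oo] --> z ^+ p ->
    (t n ^_ p.+1)%:R / (n ^_ p.+1)%:R @[n --> \oo] --> z ^+ p.+1.
  have base : (t n ^_ 0)%:R / (n ^_ 0)%:R @[n --> \oo] --> z ^+ 0.
    rewrite (_ : (fun n => _) = fun=> 1); first by rewrite expr0; exact: cvg_cst.
    by apply/funext => n; rewrite !ffactn0 divr1.
  by elim: q => [//|q /step].
move=> IH; rewrite (_ : (fun n => _) = fun n => (t n ^_ p)%:R / (n ^_ p)%:R *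
  ((t n - p)%N%:R / (n - p)%N%:R)); last first.
  by apply/funext => n; rewrite !ffactnSr !natrM -mulf_div.
rewrite exprSr.
suff q0 : (t n - p)%N%:R / (n - p)%N%:R @[n --> \oo] --> z by exact: cvgM IH q0.
have idn : n%:R / n%:R @[n --> \oo] --> (1 : R).
  apply: cvg_near_cst; near=> n.
  by rewrite divff // pnatr_eq0 -lt0n; near: n; exact: nbhs_infty_gt.
have h : (t n - p)%N%:R / n%:R / ((n - p)%N%:R / n%:R) @[n --> \oo] --> z.
  rewrite -[X in _ --> X](divr1 z); apply: cvgM; first exact: cvg_subn_ratio.
  by apply: cvgV; [exact: oner_neq0|exact: cvg_subn_ratio].
apply: cvg_trans h; apply: near_eq_cvg; near=> n.
rewrite /= invf_div mulrA divfK //.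
by rewrite pnatr_eq0 -lt0n; near: n; exact: nbhs_infty_gt.
Unshelve. all: by end_near. Qed.

(** Squeeze by [expR (- (x / (1 - x))) <= 1 - x <= expR (- x)] for [x < 1], at [x = a n / n]. *)
Lemma cvg_expr_exp (N : nat -> nat) (a : nat -> R) (u v : R) :
  (N n)%:R / n%:R @[n --> \oo] --> u -> a n @[n --> \oo] --> v ->
  (1 - a n / n%:R) ^+ N n @[n --> \oo] --> expR (- (u * v)).
Proof.
move=> Nu av.
have an0 : a n / n%:R @[n --> \oo] --> (0 : R).
  by rewrite -(mulr0 v); apply: cvgM => //; exact: cvg_natV.
have Nauv : (N n)%:R * (a n / n%:R) @[n --> \oo] --> u * v.
  rewrite (_ : (fun n => _) = fun n => (N n)%:R / n%:R * a n); first exact: cvgM.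
  by apply/funext => n; rewrite mulrAC mulrA.
apply: (@squeeze_cvgr _ _ _ _
  (fun n => expR (- ((N n)%:R * (a n / n%:R) / (1 - a n / n%:R))))
  (fun n => expR (- ((N n)%:R * (a n / n%:R))))).
- near=> n; have x1 : 0 < 1 - a n / n%:R.
    by rewrite subr_gt0; near: n; apply: (cvgr_lt (0 : R)).
  set x := a n / n%:R in x1 *.
  have expRNM y : expR (- ((N n)%:R * y)) = expR (- y) ^+ N n.
    by rewrite -mulrN expRM_natl.
  rewrite -mulrA !expRNM; apply/andP; split.
    apply: lerXn2r; rewrite ?nnegrE ?expR_ge0 ?(ltW x1) //.
    rewrite expRN -[leRHS]invrK lef_pV2 ?posrE ?expR_gt0 ?invr_gt0 //.
    rewrite [leLHS](_ : _ = 1 + x / (1 - x)); first exact: expR_ge1Dx.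
    by field; rewrite gt_eqF.
  apply: lerXn2r; rewrite ?nnegrE ?expR_ge0 ?(ltW x1) //.
  exact: expR_ge1Dx.
- apply: continuous_cvg; first exact: continuous_expR.
  apply: cvgN.
  rewrite -[X in _ --> X](divr1); apply: cvgM => //; apply: cvgV => //.
  by rewrite -[X in _ --> X]subr0; apply: cvgB => //; exact: cvg_cst.
- by apply: continuous_cvg; [exact: continuous_expR|exact: cvgN].
Unshelve. all: by end_near. Qed.

End Limits.

(** * Concentration of the number of consequences *)

Section FluidLimit.
Variables (R : realType) (k : nat) (d : k.-tuple R).
Local Open Scope classical_set_scope.
Local Open Scope ring_scope.
Hypothesis hd : forall j : nat, (1 <= j <= k)%N -> 0 <= dcoef d j.
Hypothesis hk : (0 < k)%N.
Hypothesis hd1 : dcoef d 1 < 1.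

(** Index [i] stands for width [j = i + 2], with [j - 1] variables in the body: the sum of
    [d_j z^(j-1)]. *)
Definition rate (z : R) : R := \sum_(i < k.-1) dcoef d i.+2 * z ^+ i.+1.

(** The limiting fraction of variables unreached at time [z * n]. *)
Definition survival (z : R) : R := (1 - dcoef d 1) * expR (- rate z).

Definition body_size (n : nat) (s : slot d n) : nat := (tag s).+1.

Lemma body_size_le n (s : slot d n) : (k <= n)%N -> (body_size s <= n)%N.
Proof.
move=> kn; apply: leq_trans (ltn_ord (tag s)) _.
exact: leq_trans (leq_pred k) kn.
Qed.

Lemma prod_slot n (G : nat -> R) :
  \prod_(s : slot d n) G (tag s) = \prod_(i < k.-1) G i ^+ num_clauses d n i.+2.
Proof.
rewrite -(@sig_big_dep _ _ _ 'I_k.-1 (fun i => 'I_(num_clauses d n i.+2))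
  predT (fun _ => predT) (fun i _ => G i)) /=.
by apply: eq_bigr => i _; rewrite prodr_const card_ord.
Qed.

Lemma num_clauses_ratio j : (1 <= j <= k)%N ->
  (num_clauses d n j)%:R / n%:R @[n --> \oo] --> dcoef d j.
Proof. by move=> jk; apply: cvg_truncn_ratio; apply: hd. Qed.

(** Serves twice: for the chance that a variable is missed, and for the chance that every head
    avoids its body. *)
Lemma cvg_prod_slot (a : nat -> nat -> R) (l : nat -> R) :
  (forall i, (i < k.-1)%N -> a i n @[n --> \oo] --> l i) ->
  \prod_(s : slot d n) (1 - a (tag s) n / n%:R) @[n --> \oo]
    --> expR (- \sum_(i < k.-1) dcoef d i.+2 * l i).
Proof.
move=> al; rewrite (_ : (fun n => _) = fun n =>
  \prod_(i < k.-1) (1 - a i n / n%:R) ^+ num_clauses d n i.+2); last first.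
  by apply/funext => n; rewrite (prod_slot n (fun i => 1 - a i n / n%:R)).
rewrite -sumrN expR_sum.
apply: cvg_big => [|i _]; first exact: mul_continuous.
apply: cvg_expr_exp; last exact: al.
apply: num_clauses_ratio; rewrite /=.
by have := ltn_ord i; rewrite -ltnS prednK.
Qed.

Lemma cvg_miss_prob (t : nat -> nat) (z : R) : (t n)%:R / n%:R @[n --> \oo] --> z ->
  miss_prob n (@body_size n) R 1 (t n) @[n --> \oo] --> expR (- rate z).
Proof.
move=> tz; rewrite /miss_prob /body_size.
apply: (cvg_prod_slot (a := fun i n => 1%:R * ('C(t n, i.+1)%:R / 'C(n, i.+1)%:R))
  (l := fun i => z ^+ i.+1)) => i _.
 rewrite (_ : (fun n => _) = fun n => 'C(t n, i.+1)%:R / 'C(n, i.+1)%:R).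
  exact: cvg_bin_ratio.
by apply/funext => n; rewrite mul1r.
Qed.

Lemma num_units_lt n : (0 < n)%N -> (num_clauses d n 1 < n)%N.
Proof.
move=> n0; rewrite truncn_lt_nat.
  by rewrite -[ltRHS]mul1r ltr_pM2r // ltr0n.
by rewrite mulr_ge0 // hd // hk.
Qed.

Lemma cvg_num_nonunits :
  (n - num_clauses d n 1)%:R / n%:R @[n --> \oo] --> 1 - dcoef d 1.
Proof.
suff h : 1 - (num_clauses d n 1)%:R / n%:R @[n --> \oo] --> 1 - dcoef d 1.
  apply: cvg_trans h; apply: near_eq_cvg; near=> n.
  have n0 : (0 < n)%N by near: n; exact: nbhs_infty_gt.
  rewrite natrB ?(ltnW (num_units_lt n0)) // mulrBl divff // pnatr_eq0.
  by rewrite -lt0n.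
apply: cvgB; first exact: cvg_cst.
by apply: num_clauses_ratio; rewrite hk.
Unshelve. all: by end_near. Qed.

Definition deviating n (U : {set 'I_n}) (z e : R) :=
  [set f in systems n (@body_size n) |
     e <= `|#|(~: reached U f (Num.truncn (z * n%:R)))%SET|%:R / n%:R - survival z|]%SET.

(** The mean fraction tends to [survival z]. Mean and variance bound depend on [U] only through its
    size, so the threshold on [n] is uniform in [U]. *)
Lemma reached_concentration (z e : R) : 0 <= z <= 1 -> 0 < e ->
  \forall n \near \oo, forall U : {set 'I_n}, #|U| = num_clauses d n 1 ->
    #|deviating U z e|%:R <= e * #|systems n (@body_size n)|%:R.
Proof.
move=> /andP[z0 z1] e0.
have cvm : (n - num_clauses d n 1)%:R / n%:R *
    miss_prob n (@body_size n) R 1 (Num.truncn (z * n%:R)) @[n --> \oo] --> survival z.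
  apply: cvgM; first exact: cvg_num_nonunits.
  by apply: cvg_miss_prob; exact: cvg_truncn_ratio.
near=> n => U cU.
have n2 : (2 <= n)%N by near: n; exact: nbhs_infty_ge.
have kn : (k <= n)%N by near: n; exact: nbhs_infty_ge.
(* For a deviation of [e / 2 * n] from the mean, Chebyshev gives probability at most
   [4 / (e ^+ 2 * n)], here at most [e]; the other [e / 2] pays for the distance from the mean to
   its limit. *)
have ne : 4 / e ^+ 3 <= n%:R by near: n; exact: nbhs_infty_ger.
set p := miss_prob n (@body_size n) R 1 (Num.truncn (z * n%:R)).
have close : `|survival z - (n - num_clauses d n 1)%:R / n%:R * p| < e / 2.
  by rewrite /p; near: n; move/cvgrPdist_lt: cvm; apply; rewrite divr_gt0.
have n0 : 0 < n%:R :> R by rewrite ltr0n (leq_trans _ n2).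
have tn : (Num.truncn (z * n%:R) <= n)%N.
  rewrite -(@ler_nat R); apply: (@le_trans _ _ (z * n%:R)).
    by rewrite truncn_le mulr_ge0 // ltW.
  by rewrite ler_piMl // ltW.
have var := reached_variance R (fun s => @body_size_le n s kn) U n2 tn.
rewrite cU -/p in var; set mu := (n - _)%:R * p in var.
have c0 : 0 <= e / 2 * n%:R by rewrite mulr_ge0 ?divr_ge0 // ltW.
have := le_trans (card_deviation _ _ _ c0) var; set B := [set f in _ | _]%SET.
set T := #|systems _ _|%:R => cheb.
have devB : #|deviating U z e|%:R <= #|B|%:R :> R.
  rewrite ler_nat; apply/subset_leq_card/fintype.subsetP => f.
  rewrite !finset.inE => /andP[-> /= ef]; set x := #|_|%:R in ef *.
  have -> : x - mu = (x / n%:R - mu / n%:R) * n%:R.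
    by field; rewrite gt_eqF.
  rewrite normrM (ger0_norm (ltW n0)) ler_wpM2r ?ltW //.
  have tri := ler_distD (mu / n%:R) (x / n%:R) (survival z).
  have cl : `|mu / n%:R - survival z| < e / 2 by rewrite distrC /mu mulrAC.
  move: ef tri cl; lra.
apply: le_trans devB _.
have eB : e^-1 * #|B|%:R <= T.
  rewrite -(ler_pM2l n0); apply: le_trans cheb.
  have -> : (e / 2 * n%:R) ^+ 2 * #|B|%:R = n%:R * ((e ^+ 2 / 4 * n%:R) * #|B|%:R).
    by field.
  rewrite ler_pM2l // ler_wpM2r //.
  have -> : e^-1 = e ^+ 2 / 4 * (4 / e ^+ 3) by field; rewrite gt_eqF.
  by rewrite ler_wpM2l // divr_ge0 // sqr_ge0.
by move: eB; rewrite ler_pdivrMl.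
Unshelve. all: by end_near. Qed.

Lemma continuous_survival : continuous survival.
Proof.
move=> z; apply: cvgM; first exact: cvg_cst.
apply: continuous_cvg; first exact: continuous_expR.
apply: cvgN; apply: cvg_big => [|i _]; first exact: add_continuous.
by apply: cvgM; [exact: cvg_cst|exact: exprn_continuous].
Qed.

(** * From fixed times to the first crossing time *)

Section Concentration.
Variable t0 : R.
Hypothesis t0_ge0 : 0 <= t0.
Hypothesis t0_lt1 : t0 < 1.
Hypothesis below_t0 : forall z, 0 <= z < t0 -> survival z < 1 - z.
Hypothesis above_t0 : forall e, 0 < e ->
  exists2 z, t0 < z < t0 + e & 1 - z < survival z.

(** One time [z] just right of [t0] suffices: too many consequences force more than [t] reached
    variables at [t], the truncation of [z * n], although [survival z > 1 - z]. *)
Lemma consequences_upper (e : R) : 0 < e ->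
  \forall n \near \oo, forall U : {set 'I_n}, #|U| = num_clauses d n 1 ->
    #|[set f in systems n (@body_size n) |
        (t0 + e) * n%:R <= #|consequences U f|%:R]%SET|%:R
      <= e * #|systems n (@body_size n)|%:R.
Proof.
move=> e0; have m0 : 0 < Num.min e (1 - t0) by rewrite lt_min e0 subr_gt0.
have [z /andP[z0 ze] sz] := above_t0 m0.
have [zlt zt0] : z < 1 /\ z < t0 + e.
  by move: ze; rewrite -ltrBlDl lt_min => /andP[]; split; lra.
have z_ge0 : 0 <= z := le_trans t0_ge0 (ltW z0).
(* The first entry bounds the probability, the second is the deviation forced at [z]. *)
pose c := Num.min e (survival z - (1 - z)).
have c0 : 0 < c by rewrite /c lt_min e0 subr_gt0.
near=> n => U cU.
have n0 : (0 < n)%N by near: n; exact: nbhs_infty_gt.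
have n0' : 0 < n%:R :> R by rewrite ltr0n.
have dev : #|deviating U z c|%:R <= c * #|systems n (@body_size n)|%:R.
  move: (U) (cU); near: n; apply: reached_concentration => //.
  by rewrite z_ge0 ltW.
have i0 : 'I_n := Ordinal n0.
set t := Num.truncn (z * n%:R).
have [tz zt] : t%:R <= z * n%:R /\ z * n%:R < t.+1%:R.
  by apply/andP/truncn_itv; rewrite mulr_ge0 // ltW.
have tn : (t <= n)%N.
  by rewrite -(@ler_nat R) (le_trans tz) // ler_piMl ?ltW.
apply: le_trans (_ : #|deviating U z c|%:R <= _); last first.
  by rewrite (le_trans dev) // ler_wpM2r // /c ge_min lexx.
rewrite -(card_relabel_systems _ i0 U).
rewrite ler_nat; apply/subset_leq_card/fintype.subsetP => f /setIdP[fE large].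
apply/setIdP; split=> //.
have tr : (t < #|reached U f t|)%N.
  rewrite ltnNge; apply: contraTN large => /(consequences_relabel_le i0 tn).
  rewrite -(@ler_nat R) -ltNge => /le_lt_trans; apply.
  by rewrite (le_lt_trans tz) // ltr_pM2r.
rewrite -/t finset.cardsCs finset.setCK card_ord distrC.
apply: le_trans (ler_norm _); apply: le_trans (_ : survival z - (1 - z) <= _).
  by rewrite /c ge_min lexx orbT.
rewrite lerD2l lerN2 ler_pdivrMr // mulrBl mul1r natrB; last first.
  by rewrite -[leqRHS]card_ord max_card.
(* The strict [t < #|reached U f t|] absorbs the truncation, as [z * n < t + 1]. *)
rewrite lerD2l lerN2; apply: le_trans (ltW zt) _.
by rewrite ler_nat.
Unshelve. all: by end_near. Qed.

(** By compactness: a continuous function positive on [[0, t1]] attains its minimum there. *)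
Lemma survival_gap (t1 : R) : 0 <= t1 < t0 ->
  exists2 g, 0 < g & forall z, 0 <= z <= t1 -> g <= 1 - z - survival z.
Proof.
move=> /andP[t1_ge0 t1_lt].
have ct : {within `[0, t1], continuous (fun z => 1 - z - survival z)}.
  apply: continuous_subspaceT => z; apply: cvgB; last exact: continuous_survival.
  by apply: cvgB; [exact: cvg_cst|exact: cvg_id].
have [c c01 cmin] := EVT_min t1_ge0 ct.
exists (1 - c - survival c) => [|z z01]; last by apply: cmin; rewrite in_itv.
move: c01; rewrite in_itv /= => /andP[c0 ct1].
by rewrite subr_gt0 below_t0 // c0 (le_lt_trans ct1).
Qed.

(** Too few consequences give some time [u < t] with at most [u] variables reached. Since [reached]
    grows with time, the grid point just below [u / n] already deviates; a union bound over a grid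
    of fixed size concludes. *)
Lemma consequences_lower (e : R) : 0 < e ->
  \forall n \near \oo, forall U : {set 'I_n}, #|U| = num_clauses d n 1 ->
    #|[set f in systems n (@body_size n) |
        #|consequences U f|%:R <= (t0 - e) * n%:R]%SET|%:R
      <= e * #|systems n (@body_size n)|%:R.
Proof.
move=> e0; have [t1_lt0|t1_ge0] := ltP (t0 - e / 2) 0.
  near=> n => U cU.
  apply: (@le_trans _ _ 0); last by rewrite mulr_ge0 // ltW.
  rewrite lern0 finset.cards_eq0; apply/eqP/finset.setP => f.
  rewrite finset.in_set0; apply/negbTE; rewrite finset.inE.
  rewrite negb_and -ltNge orbC (@lt_le_trans _ _ 0) // pmulr_llt0; last first.
    by rewrite ltr0n; near: n; exact: nbhs_infty_gt.
  lra.
have t1_int : 0 <= t0 - e / 2 < t0 by rewrite t1_ge0 /=; lra.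
have [g g0 gap] := survival_gap t1_int.
(* Mesh at most [g / 2]: rounding [u / n] down to the grid loses at most half of the gap. *)
pose M := (Num.truncn (2 / g)).+1.
have M0 : 0 < M%:R :> R by rewrite ltr0n.
have gM : M%:R^-1 <= g / 2.
  rewrite -[leRHS]invrK lef_pV2 ?posrE ?invr_gt0 ?divr_gt0 // invf_div.
  exact/ltW/truncnS_gt.
(* The other half of the gap, and a share [e / M] of the probability for each grid point. *)
pose c := Num.min (g / 2) (e / M%:R).
have c0 : 0 < c by rewrite /c lt_min !divr_gt0.
have conc : \forall n \near \oo, forall (i : 'I_M) (U : {set 'I_n}),
    #|U| = num_clauses d n 1 ->
    #|deviating U (i%:R / M%:R) c|%:R <= c * #|systems n (@body_size n)|%:R.
  apply: filter_forall => i; apply: reached_concentration => //.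
  by rewrite divr_ge0 //= ler_pdivrMr // mul1r ler_nat ltnW.
near=> n => U cU.
have n0 : (0 < n)%N by near: n; exact: nbhs_infty_gt.
have n0' : 0 < n%:R :> R by rewrite ltr0n.
(* Makes [e / 2 * n] exceed 1, so that [t] stays above [(t0 - e) * n] despite truncation. *)
have ne : 2 / e < n%:R by near: n; exact: nbhs_infty_gtr.
have dev : forall i : 'I_M,
    #|deviating U (i%:R / M%:R) c|%:R <= c * #|systems n (@body_size n)|%:R.
  by move=> i; move: i U cU; near: n.
have i0 : 'I_n := Ordinal n0.
set t1 := t0 - e / 2 in t1_ge0 gap.
set t := Num.truncn (t1 * n%:R).
have [tt1 t1t] : t%:R <= t1 * n%:R /\ t1 * n%:R < t.+1%:R.
  by apply/andP/truncn_itv; rewrite mulr_ge0 // ltW.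
have t1_lt1 : t1 < 1 by rewrite /t1; move: e0 t0_lt1; lra.
have tn : (t <= n)%N.
  by rewrite -(@ler_nat R) (le_trans tt1) // ler_piMl ?ltW.
rewrite -(card_relabel_systems _ i0 U).
apply: le_trans (_ : (\sum_(i < M) #|deviating U (i%:R / M%:R) c|)%:R <= _); last first.
  rewrite natr_sum; apply: (@le_trans _ _ (\sum_(i < M)
      c * #|systems n (@body_size n)|%:R)); first exact: ler_sum.
  rewrite sumr_const card_ord -[leLHS]mulr_natl mulrA ler_wpM2r // mulrC -ler_pdivlMr //.
  by rewrite /c ge_min lexx orbT.
rewrite ler_nat.
apply: leq_trans (_ : #|\bigcup_(i < M) deviating U (i%:R / M%:R) c|%SET <= _)%N; last first.
  elim/big_rec2: _ => [|i B m _ Bm]; first by rewrite finset.cards0.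
  by rewrite (leq_trans (leq_card_setU _ _)) // leq_add2l.
apply/subset_leq_card/fintype.subsetP => f /setIdP[fE small].
have [u ut ru] : exists2 u, (u < t)%N & (#|reached U f u| <= u)%N.
  have [/existsP[u ru]|/existsPn none] := boolP [exists u : 'I_t, #|reached U f u| <= u]%N.
    by exists u.
  have /(consequences_relabel_ge i0 tn) : forall u, (u < t)%N -> (u < #|reached U f u|)%N.
    by move=> u ut; have := none (Ordinal ut); rewrite -ltnNge.
  rewrite leqNgt -(@ltr_nat R) (le_lt_trans small) //.
  move: t1t ne; rewrite -[t.+1%:R]natr1 ltr_pdivrMr // /t1; lra.
have un : (u < n)%N := leq_trans ut tn.
pose i := Num.truncn (u%:R * M%:R / n%:R : R).
have [iu ui] : i%:R <= u%:R * M%:R / n%:R :> R /\ u%:R * M%:R / n%:R < i.+1%:R :> R.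
  by apply/andP/truncn_itv; rewrite divr_ge0 ?mulr_ge0.
have iM : (i < M)%N.
  rewrite -(@ltr_nat R) (le_lt_trans iu) // ltr_pdivrMr // mulrC ltr_pM2l //.
  by rewrite ltr_nat.
apply/bigcupP; exists (Ordinal iM) => //=; apply/setIdP; split=> //.
set z := i%:R / M%:R; have z_ge0 : 0 <= z by rewrite divr_ge0.
have zu : z * n%:R <= u%:R.
  by rewrite /z mulrAC ler_pdivrMr // -ler_pdivlMr.
have uz : u%:R / n%:R <= z + M%:R^-1.
  rewrite /z -[X in _ <= _ + X]mul1r -mulrDl natr1 ler_pdivlMr // mulrAC.
  exact: ltW.
have zt1 : z <= t1.
  by rewrite -(ler_pM2r n0') (le_trans zu) // (le_trans _ tt1) // ler_nat ltnW.
set v := Num.truncn _.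
have vu : (v <= u)%N.
  by rewrite -(@ler_nat R) (le_trans _ zu) // truncn_le mulr_ge0 // ltW.
have rv : (#|reached U f v| <= u)%N.
  exact: leq_trans (subset_leq_card (reached_sub U f vu)) ru.
have gz := gap z (introT andP (conj z_ge0 zt1)).
rewrite finset.cardsCs finset.setCK card_ord.
apply: le_trans (ler_norm _); apply: le_trans (_ : g / 2 <= _).
  by rewrite /c ge_min lexx.
(* The unreached fraction is at least [1 - u / n >= 1 - z - 1 / M], whereas
   [survival z <= 1 - z - g]. *)
have : 1 - u%:R / n%:R <= (n - #|reached U f v|)%:R / n%:R :> R.
  rewrite ler_pdivlMr // mulrBl mul1r divfK ?gt_eqF // natrB; last first.
    by rewrite -[leqRHS]card_ord max_card.
  by rewrite lerD2l lerN2 ler_nat.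
move: uz gz gM; lra.
Unshelve. all: by end_near. Qed.

Lemma consequences_concentration (e : R) : 0 < e ->
  \forall n \near \oo, forall U : {set 'I_n}, #|U| = num_clauses d n 1 ->
    #|[set f in systems n (@body_size n) |
        e <= `|#|consequences U f|%:R / n%:R - t0| ]%SET|%:R
      <= e * #|systems n (@body_size n)|%:R.
Proof.
move=> e0; have e2 : 0 < e / 2 by rewrite divr_gt0.
near=> n => U cU.
have n0 : 0 < n%:R :> R by rewrite ltr0n; near: n; exact: nbhs_infty_gt.
have up : #|[set f in systems n (@body_size n) |
    (t0 + e / 2) * n%:R <= #|consequences U f|%:R]%SET|%:R
      <= e / 2 * #|systems n (@body_size n)|%:R.
  by move: (U) (cU); near: n; exact: consequences_upper.
have lo : #|[set f in systems n (@body_size n) |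
    #|consequences U f|%:R <= (t0 - e / 2) * n%:R]%SET|%:R
      <= e / 2 * #|systems n (@body_size n)|%:R.
  by move: (U) (cU); near: n; exact: consequences_lower.
rewrite [e in leRHS]splitr mulrDl; apply: le_trans (lerD up lo).
rewrite -natrD ler_nat; apply: leq_trans (leq_card_setU _ _).
apply/subset_leq_card/fintype.subsetP => f /setIdP[fE].
rewrite ler_normr => /orP dev; apply/setUP.
case: dev => dev; [left|right]; apply/setIdP; split => //.
  by rewrite -ler_pdivlMr //; lra.
by rewrite -ler_pdivrMr //; lra.
Unshelve. all: by end_near. Qed.

End Concentration.
End FluidLimit.

(** * Definite clauses as pairs, and symmetry between the variables *)

Section Encoding.
Import mathcomp.boot.fintype mathcomp.boot.finset.

Variable n : nat.
Implicit Types (p : 'I_n * {set 'I_n}) (U : {set 'I_n}).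

Definition definite_clause p : clause n :=
  (p.1, true) |: [set (i, false) | i in p.2].

Lemma mem_definite_clause p i b :
  ((i, b) \in definite_clause p) = if b then i == p.1 else i \in p.2.
Proof.
rewrite in_setU1 xpair_eqE; case: b.
  by rewrite andbT orbC; case: imsetP => // -[].
by rewrite andbF /= mem_imset // => x y [].
Qed.

Lemma definite_clause_inj : injective definite_clause.
Proof.
move=> [h B] [h' B'] /setP e.
have := e (h, true); rewrite !mem_definite_clause /= eqxx => /esym/eqP ->.
congr (_, _); apply/setP => i.
by have := e (i, false); rewrite !mem_definite_clause.
Qed.

(** The pairs whose clause does not contain both literals of a variable. *)
Definition proper_rules (q : nat) : {set 'I_n * {set 'I_n}} :=
  [set p : 'I_n * {set 'I_n} | (#|p.2| == q) && (p.1 \notin p.2)].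

Lemma card_definite_clause p : #|definite_clause p| = #|p.2|.+1.
Proof.
rewrite cardsU1 card_imset; last by move=> x y [].
by case: imsetP => // -[].
Qed.

Lemma pos_definite_clause p : pos_literals (definite_clause p) = [set (p.1, true)].
Proof.
apply/setP => -[i b]; rewrite inE mem_definite_clause in_set1 xpair_eqE /=.
by case: b; rewrite ?andbT ?andbF.
Qed.

Lemma vars_definite_clause p : clause_vars (definite_clause p) = p.1 |: p.2.
Proof.
apply/setP => i; rewrite in_setU1; apply/imsetP/orP => [[[j b]]|[/eqP ->|ip]].
- by rewrite mem_definite_clause /= => jb ->; case: b jb => ?; [left|right].
- by exists (p.1, true); rewrite ?mem_definite_clause.
- by exists (i, false); rewrite ?mem_definite_clause.
Qed.

Lemma definite_clauses_imset q :
  definite_clauses n q.+1 = definite_clause @: proper_rules q.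
Proof.
apply/setP => c; apply/idP/imsetP => [|[p]]; last first.
  rewrite inE => /andP[/eqP pq hp] ->; rewrite inE /horn pos_definite_clause cards1.
  by rewrite vars_definite_clause cardsU1 hp card_definite_clause pq !eqxx.
rewrite inE => /and4P[_ /eqP cv /eqP cc /cards1P[[x b] cx]].
have posE i : ((i, true) \in c) = (i == x) && b.
  have := in_set1 (i, true) (x, b); rewrite -cx inE andbT => ->.
  by rewrite xpair_eqE; case: b {cx}.
have : (x, b) \in pos_literals c by rewrite cx set11.
rewrite inE /= => /andP[_ bT]; rewrite {}bT in posE cx.
pose B := [set i | (i, false) \in c].
have cE : c = definite_clause (x, B).
  apply/setP => -[i b']; rewrite mem_definite_clause /=; case: b'.
    by rewrite posE andbT.
  by rewrite inE.
exists (x, B) => //; rewrite inE /=.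
(* If [x] were in [B], the clause would have one more literal than variables. *)
move: cv cc; rewrite {1 2}cE vars_definite_clause card_definite_clause cardsU1 /=.
by case: (x \in B) => /= [<- /eqP|_ [->]]; rewrite ?eqxx // add0n gtn_eqF.
Qed.

Lemma card_proper_rules q : #|proper_rules q| = ((n - q) * 'C(n, q))%N.
Proof.
rewrite -(card_imset _ definite_clause_inj) -definite_clauses_imset.
by rewrite card_definite_clauses mul_bin_left.
Qed.

Lemma clause_sat_definite (v : {ffun 'I_n -> bool}) p :
  clause_sat v (definite_clause p) = (p.2 \subset [set i | v i]) ==> (p.1 \in [set i | v i]).
Proof.
rewrite inE; apply/existsP/implyP => [[[i b]]|h].
  rewrite mem_definite_clause /=; case: b => /andP[ip /eqP vi].
    by rewrite -(eqP ip) vi.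
  by move/subsetP/(_ _ ip); rewrite inE vi.
have [/h vp|/subsetPn[i ip]] := boolP (p.2 \subset [set i | v i]).
  by exists (p.1, true); rewrite mem_definite_clause /= eqxx vp.
by rewrite inE => /negbTE vi; exists (i, false); rewrite mem_definite_clause /= ip vi.
Qed.

Variable S : finType.
Implicit Types f : {ffun S -> 'I_n * {set 'I_n}}.

Lemma stable_set_sat U f (v : {ffun 'I_n -> bool}) :
  stable_set U f [set i | v i] =
  [forall i in U, v i] && [forall s, clause_sat v (definite_clause (f s))].
Proof.
rewrite /stable_set subUset; congr (_ && _).
  apply/subsetP/forall_inP => h i /h; by rewrite inE.
apply/subsetP/forallP => [h s|h i /imsetP[s]].
  rewrite clause_sat_definite; apply/implyP => sB; apply: h.
  by apply/imsetP; exists s; rewrite ?inE.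
by rewrite inE => sB ->; have := h s; rewrite clause_sat_definite sB.
Qed.

Definition permute (sg : {perm 'I_n}) (w : {set 'I_n} * {ffun S -> 'I_n * {set 'I_n}}) :
    {set 'I_n} * {ffun S -> 'I_n * {set 'I_n}} :=
  (sg @: w.1, [ffun s => (sg (w.2 s).1, sg @: (w.2 s).2)]).

Lemma permuteM (s t : {perm 'I_n}) w : permute t (permute s w) = permute (s * t)%g w.
Proof.
have st (A : {set 'I_n}) : t @: (s @: A) = (s * t)%g @: A.
  by rewrite -imset_comp; apply: eq_imset => x /=; rewrite permM.
rewrite /permute st; congr (_, _); apply/ffunP => x; rewrite !ffunE /=.
by rewrite st permM.
Qed.

Lemma permute1 w : permute 1%g w = w.
Proof.
have id1 (A : {set 'I_n}) : (1%g : {perm 'I_n}) @: A = A.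
  by rewrite -[RHS]imset_id; apply: eq_imset => x; rewrite perm1.
case: w => U f; rewrite /permute id1; congr (_, _); apply/ffunP => s.
by rewrite ffunE /= id1 perm1 -surjective_pairing.
Qed.

Lemma perm_imset_sub (sg : {perm 'I_n}) (A B : {set 'I_n}) :
  (sg @: A \subset sg @: B) = (A \subset B).
Proof.
apply/idP/idP => [/subsetP sAB|]; last exact: imsetS.
by apply/subsetP => x xA; rewrite -(mem_imset _ _ (@perm_inj _ sg)) sAB ?imset_f.
Qed.

Lemma stable_permute sg w (P : {set 'I_n}) :
  stable_set (permute sg w).1 (permute sg w).2 (sg @: P) = stable_set w.1 w.2 P.
Proof.
rewrite /stable_set !subUset perm_imset_sub; congr (_ && _).
apply/subsetP/subsetP => h x /imsetP[s]; rewrite inE => sB ->.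
  rewrite -(mem_imset _ _ (@perm_inj _ sg)); apply: h.
  by apply/imsetP; exists s; rewrite ?inE ffunE /= ?perm_imset_sub.
rewrite ffunE /= imset_f //; apply: h; apply/imsetP; exists s => //.
by rewrite inE; move: sB; rewrite ffunE /= perm_imset_sub.
Qed.

(** Permutations carry stable sets to stable sets, hence also their intersection. *)
Lemma consequences_permute (sg : {perm 'I_n}) w x :
  (sg x \in consequences (permute sg w).1 (permute sg w).2)
    = (x \in consequences w.1 w.2).
Proof.
apply: negb_inj; apply/notin_consequencesP/notin_consequencesP => -[P].
  have -> : P = sg @: (sg^-1%g @: P).
    by rewrite -imset_comp -[LHS]imset_id; apply: eq_imset => y /=; rewrite permKV.
  by rewrite stable_permute mem_imset //; [exists (sg^-1%g @: P)|exact: perm_inj].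
by move=> sP xP; exists (sg @: P); rewrite ?stable_permute // mem_imset //; exact: perm_inj.
Qed.

(* Averaging over the transpositions of [i0] with the other variables. *)
Lemma card_symmetric (W : {set {set 'I_n} * {ffun S -> 'I_n * {set 'I_n}}})
    (T : {set 'I_n} * {ffun S -> 'I_n * {set 'I_n}} -> {set 'I_n}) (i0 : 'I_n) :
  (forall (sg : {perm 'I_n}) w, (permute sg w \in W) = (w \in W)) ->
  (forall (sg : {perm 'I_n}) w x, (sg x \in T (permute sg w)) = (x \in T w)) ->
  (n * #|[set w in W | i0 \notin T w]| = \sum_(w in W) (n - #|T w|))%N.
Proof.
move=> symW symT.
have eqi i : #|[set w in W | i \notin T w]| = #|[set w in W | i0 \notin T w]|.
  pose sg := tperm i0 i.
  have sgK : involutive (permute sg) by move=> w; rewrite permuteM tperm2 permute1.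
  rewrite -[LHS](card_preimset _ (inv_inj sgK)); apply: eq_card => w.
  rewrite inE; apply/setIdP/setIdP; rewrite symW -(symT sg) permuteM tperm2 permute1;
    by rewrite ?tpermR ?tpermL.
have -> : (n * #|[set w in W | i0 \notin T w]| =
    \sum_(i < n) #|[set w in W | i \notin T w]|)%N.
  by rewrite (eq_bigr _ (fun i _ => eqi i)) sum_nat_const card_ord.
rewrite (eq_bigr (fun i => \sum_(w in W) (i \notin T w : nat))%N) => [|i _]; last first.
  rewrite -sum1dep_card big_mkcondr; apply: eq_bigr => w _.
  by case: (i \in T w).
rewrite exchange_big; apply: eq_bigr => w _ /=.
rewrite -[X in (X - _)%N](card_ord n) -[T w in RHS]setCK -cardsCs -sum1_card [RHS]big_mkcond.
by apply: eq_bigr => i _; rewrite in_setC; case: (i \in T w).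
Qed.

End Encoding.

(** * The random formula inside a symmetric sample space *)

Section Outcomes.
Import mathcomp.boot.fintype mathcomp.boot.finset.

Variables (R : realType) (k : nat) (d : k.-tuple R) (n : nat) (i0 : 'I_n).
Hypothesis i0E : val i0 = 0%N.

Definition proper_systems : {set {ffun slot d n -> 'I_n * {set 'I_n}}} :=
  [set f : {ffun slot d n -> 'I_n * {set 'I_n}} |
    [forall s, f s \in proper_rules n (body_size s)]].

Lemma proper_systems_sub : proper_systems \subset systems n (@body_size _ _ d n).
Proof.
apply/subsetP => f; rewrite !inE => /forallP h; apply/forallP => s.
by have := h s; rewrite inE => /andP[].
Qed.

Lemma card_proper_systems :
  #|proper_systems| = (\prod_(s : slot d n) ((n - body_size s) * 'C(n, body_size s)))%N.
Proof.
have -> : #|proper_systems| = #|family (fun s : slot d n => proper_rules n (body_size s))|.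
  by apply: eq_card => f; rewrite inE; apply/forallP/familyP.
rewrite card_family foldrE big_map big_enum /=.
by apply: eq_bigr => s _; rewrite card_proper_rules.
Qed.

(** Here x_1 may be a unit, unlike in [outcomes]: the space becomes invariant under all permutations
    of the variables. *)
Definition samples := [set w : {set 'I_n} * {ffun slot d n -> 'I_n * {set 'I_n}} |
  (#|w.1| == num_clauses d n 1) && (w.2 \in proper_systems)].

Definition encode (w : {set 'I_n} * {ffun slot d n -> 'I_n * {set 'I_n}}) :
    {set 'I_n} * {ffun slot d n -> clause n} :=
  (w.1, [ffun s => definite_clause (w.2 s)]).

Lemma encode_inj : injective encode.
Proof.
move=> [U f] [V g] [-> /ffunP e]; congr (_, _); apply/ffunP => s.
by apply: definite_clause_inj; have := e s; rewrite !ffunE.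
Qed.

Lemma outcomes_encode : outcomes d n = encode @: [set w in samples | i0 \notin w.1].
Proof.
have i0P (U : {set 'I_n}) : [forall i in U, val i != 0%N] = (i0 \notin U).
  apply/forall_inP/idP => [h|iU i]; first by apply/negP => /h; rewrite i0E.
  by apply: contraTneq => i_eq; rewrite (_ : i = i0) //; apply: val_inj; rewrite i0E.
apply/setP => -[U g]; apply/idP/imsetP => [|[[V f]]].
  rewrite inE /= i0P => /and3P[cU iU /forallP gd].
  have ex s : exists p, (p \in proper_rules n (body_size s)) && (g s == definite_clause p).
    have := gd s; rewrite definite_clauses_imset => /imsetP[p pp ->].
    by exists p; rewrite pp eqxx.
  exists (U, [ffun s => xchoose (ex s)]).
    rewrite !inE /= cU iU andbT; apply/forallP => s.
    by rewrite ffunE; have /andP[] := xchooseP (ex s).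
  congr (_, _); apply/ffunP => s; rewrite !ffunE.
  by have /andP[_ /eqP] := xchooseP (ex s).
move=> /setIdP[]; rewrite inE /= => /andP[cV]; rewrite inE => /forallP fp iV [-> ->].
rewrite inE /= cV i0P iV; apply/forallP => s.
by rewrite ffunE [definite_clauses _ _]definite_clauses_imset imset_f // fp.
Qed.

(** Assignments are identified with their sets of true variables: models are the stable sets that
    avoid x_1. *)
Lemma satisfiable_encode w :
  satisfiable (formula (encode w)) = (i0 \notin consequences w.1 w.2).
Proof.
have satE (v : {ffun 'I_n -> bool}) : all (clause_sat v) (formula (encode w)) =
    (i0 \notin [set i | v i]) && stable_set w.1 w.2 [set i | v i].
  rewrite /= all_cat stable_set_sat inE; congr [&& _, _ & _].
  - apply/existsP/idP => [[[i b]]|vi]; last first.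
      by exists (i0, false); rewrite inE /= i0E (negbTE vi).
    rewrite inE /= => /andP[/andP[i_eq]]; case: b => // _ /eqP vi.
    by rewrite (_ : i0 = i) ?vi //; apply: val_inj; rewrite i0E; apply/esym/eqP.
  - have unitE i : clause_sat v [set (i, true)] = v i.
      apply/existsP/idP => [[l]|vi]; last by exists (i, true); rewrite set11 vi.
      by rewrite in_set1 => /andP[/eqP -> /= /eqP].
    apply/allP/forall_inP => [h i iU|h c /imageP[i iU ->]]; last by rewrite unitE h.
    by rewrite -unitE h //; apply: image_f.
  - apply/allP/forallP => [h s|h c /imageP[s _ ->]]; last by rewrite ffunE h.
    by apply: h; apply/imageP; exists s; rewrite ?ffunE.
apply/existsP/notin_consequencesP => [[v]|[P sP iP]].
  by rewrite satE => /andP[iv sv]; exists [set i | v i].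
have PE : [set i | [ffun i => i \in P] i] = P by apply/setP => i; rewrite inE ffunE.
by exists [ffun i => i \in P]; rewrite satE PE iP.
Qed.

Lemma satisfiable_outcomes :
  [set w in outcomes d n | satisfiable (formula w)]
    = encode @: [set w in samples | i0 \notin consequences w.1 w.2].
Proof.
apply/setP => w; apply/setIdP/imsetP => [[]|[w' /setIdP[ws iw] ->]].
  rewrite outcomes_encode => /imsetP[w' /setIdP[ws iw] ->].
  by rewrite satisfiable_encode => h; exists w' => //; apply/setIdP.
rewrite outcomes_encode satisfiable_encode iw imset_f //; apply/setIdP; split=> //.
by apply: contra iw; apply: (subsetP (sub_consequences _ _)).
Qed.

Lemma permute_samples sg w : (permute sg w \in samples) = (w \in samples).
Proof.
have sgI := @perm_inj _ sg.
rewrite [LHS]inE [RHS]inE /= card_imset //; congr (_ && _).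
rewrite [LHS]inE [RHS]inE; apply: eq_forallb => s.
by rewrite ffunE [LHS]inE [RHS]inE /= card_imset // mem_imset.
Qed.

Local Open Scope ring_scope.

Lemma sat_prob_samples : (0 < n - num_clauses d n 1)%N -> (0 < #|samples|)%N ->
  sat_prob d n = (\sum_(w in samples) (n - #|consequences w.1 w.2|)%N%:R)
    / ((n - num_clauses d n 1)%N%:R * #|samples|%:R).
Proof.
move=> nm0 s0; rewrite /sat_prob satisfiable_outcomes outcomes_encode.
rewrite !(card_imset _ encode_inj).
have n0 : n%:R != 0 :> R by rewrite pnatr_eq0; case: (n) i0 => // -[].
(* After multiplication by [n], symmetry turns both counts into sums: of [n - #|consequences|]
   above, of [n - #|U|] below. *)
rewrite -[LHS]mulr1 -[X in _ * X](divff n0) mulf_div -!natrM ![(_ * n)%N]mulnC.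
rewrite (card_symmetric (T := fun w => consequences w.1 w.2) _ permute_samples); last first.
  exact: consequences_permute.
rewrite (card_symmetric (T := fun w => w.1) _ permute_samples); last first.
  by move=> sg w x /=; rewrite mem_imset //; exact: perm_inj.
congr (_ / _); first by rewrite natr_sum.
rewrite (eq_bigr (fun=> n - num_clauses d n 1)%N) => [|w]; last first.
  by rewrite inE => /andP[/eqP ->].
by rewrite sum_nat_const mulnC natrM.
Qed.

End Outcomes.

(** * The satisfiability probability *)

Section Averaging.
Variables (R : realType) (k : nat) (d : k.-tuple R).
Local Open Scope classical_set_scope.
Local Open Scope ring_scope.
Hypothesis hd : forall j : nat, (1 <= j <= k)%N -> 0 <= dcoef d j.
Hypothesis hk : (0 < k)%N.
Hypothesis hd1 : dcoef d 1 < 1.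

(* Conditioning on [h \notin B] in every slot costs only a constant factor. *)
Lemma systems_le_proper : exists2 K : R, 0 < K &
  \forall n \near \oo, #|systems n (@body_size _ _ d n)|%:R <= K * #|proper_systems d n|%:R.
Proof.
(* Each factor is the chance that an independent head avoids its body. *)
have lim : \prod_(s : slot d n) (1 - (tag s).+1%:R / n%:R) @[n --> \oo]
    --> expR (- \sum_(i < k.-1) dcoef d i.+2 * i.+1%:R).
  apply: (cvg_prod_slot hd hk (a := fun i _ => i.+1%:R) (l := fun i => i.+1%:R)).
  by move=> i _; exact: cvg_cst.
set l := expR _ in lim; have l0 : 0 < l by exact: expR_gt0.
exists (2 / l); first by rewrite divr_gt0.
near=> n.
have n0 : (0 < n)%N by near: n; exact: nbhs_infty_gt.
have kn : (k <= n)%N by near: n; exact: nbhs_infty_ge.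
have half : l / 2 < \prod_(s : slot d n) (1 - (tag s).+1%:R / n%:R).
  by near: n; apply: (cvgr_gt l lim); rewrite ltr_pdivrMr // ltr_pMr // ltr1n.
have T0 : 0 < #|systems n (@body_size _ _ d n)|%:R :> R.
  by rewrite ltr0n card_systems_gt0 // => s; exact: body_size_le.
have -> : #|proper_systems d n|%:R = #|systems n (@body_size _ _ d n)|%:R *
    \prod_(s : slot d n) (1 - (tag s).+1%:R / n%:R) :> R.
  rewrite card_proper_systems card_systems !natr_prod -big_split /=.
  apply: eq_bigr => s _; rewrite !natrM natrB ?body_size_le //.
  by rewrite /body_size; field; rewrite pnatr_eq0 -lt0n.
rewrite mulrCA -{1}[X in X <= _]mulr1 ler_wpM2l //.
by rewrite -ler_pdivrMl ?divr_gt0 // mulr1 invf_div ltW.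
Unshelve. all: by end_near. Qed.

Variable t0 : R.
Hypothesis t0_int : 0 <= t0 <= 1.
Hypothesis concentrated : forall e, 0 < e ->
  \forall n \near \oo, forall U : {set 'I_n}, #|U| = num_clauses d n 1 ->
    #|[set f in systems n (@body_size _ _ d n) |
        e <= `|#|consequences U f|%:R / n%:R - t0| ]%SET|%:R
      <= e * #|systems n (@body_size _ _ d n)|%:R.

(** The deviation is at most 1, hence at most [c] plus the indicator of being at least [c]; passing
    from [systems] to [proper_systems] costs the factor [K], whence [c = e / (1 + K)]. *)
Lemma mean_deviation (e : R) : 0 < e ->
  \forall n \near \oo, forall U : {set 'I_n}, #|U| = num_clauses d n 1 ->
    \sum_(f in proper_systems d n) `|#|consequences U f|%:R / n%:R - t0|
      <= e * #|proper_systems d n|%:R.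
Proof.
move=> e0; have [K K0 HK] := systems_le_proper.
pose c := e / (1 + K); have c0 : 0 < c by rewrite divr_gt0 // addr_gt0.
near=> n => U cU.
have n0 : 0 < n%:R :> R by rewrite ltr0n; near: n; exact: nbhs_infty_gt.
have TP : #|systems n (@body_size _ _ d n)|%:R <= K * #|proper_systems d n|%:R by near: n.
pose h (f : {ffun slot d n -> 'I_n * {set 'I_n}}) := `|#|consequences U f|%:R / n%:R - t0|.
have dev : #|[set f in systems n (@body_size _ _ d n) | c <= h f]%SET|%:R
    <= c * #|systems n (@body_size _ _ d n)|%:R.
  by rewrite /h; move: (U) (cU); near: n; exact: concentrated.
have h1 f : h f <= 1.
  have x0 : 0 <= #|consequences U f|%:R / n%:R :> R by rewrite divr_ge0.
  have x1 : #|consequences U f|%:R / n%:R <= 1 :> R.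
    by rewrite ler_pdivrMr // mul1r ler_nat -[leqRHS]card_ord max_card.
  by case/andP: t0_int => t00 t01; rewrite /h ler_norml; lra.
apply: (@le_trans _ _ (\sum_(f in proper_systems d n) (c + (c <= h f)%R%:R))).
  apply: ler_sum => f _; rewrite -/(h f); have := h1 f.
  by case: (lerP c (h f)) => /= hf hf1; rewrite ?addr0 ?(ltW hf) // (le_trans hf1) // lerDr ltW.
rewrite big_split /= sumr_const -[X in X + _]mulr_natr.
apply: (@le_trans _ _ (c * #|proper_systems d n|%:R + c * (K * #|proper_systems d n|%:R))).
  rewrite lerD2l; apply: le_trans (_ : c * #|systems n (@body_size _ _ d n)|%:R <= _); last first.
    by rewrite ler_pM2l.
  apply: le_trans dev; rewrite -natr_sum ler_nat -big_mkcondr /= sum1dep_card.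
  apply/subset_leq_card/fintype.subsetP => f; rewrite finset.inE => /andP[fP hf].
  apply/setIdP; split => //; exact: (fintype.subsetP (proper_systems_sub d n)).
have -> : c * #|proper_systems d n|%:R + c * (K * #|proper_systems d n|%:R) =
  c * (1 + K) * #|proper_systems d n|%:R by ring.
by rewrite /c divfK // gt_eqF // addr_gt0.
Unshelve. all: by end_near. Qed.

Lemma sum_samples n (F : {set 'I_n} * {ffun slot d n -> 'I_n * {set 'I_n}} -> R) :
  \sum_(w in samples d n) F w = \sum_(U : {set 'I_n} | #|U| == num_clauses d n 1)
    \sum_(f in proper_systems d n) F (U, f).
Proof.
rewrite pair_big_dep /=; apply: eq_big => [w|[U f] _ //].
by rewrite finset.inE.
Qed.

Lemma sat_prob_cvg : sat_prob d n @[n --> \oo] --> (1 - t0) / (1 - dcoef d 1).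
Proof.
have d10 : 1 - dcoef d 1 != 0 by rewrite subr_eq0 gt_eqF.
have [K K0 HK] := systems_le_proper.
have samples_gt0 : \forall n \near \oo, (0 < #|samples d n|)%N.
  near=> n.
  have n0 : (0 < n)%N by near: n; exact: nbhs_infty_gt.
  have kn : (k <= n)%N by near: n; exact: nbhs_infty_ge.
  have TP : #|systems n (@body_size _ _ d n)|%:R <= K * #|proper_systems d n|%:R by near: n.
  have T0 : 0 < #|systems n (@body_size _ _ d n)|%:R :> R.
    by rewrite ltr0n card_systems_gt0 // => s; exact: body_size_le.
  have /card_gt0P[f fP] : (0 < #|proper_systems d n|)%N.
    by rewrite -(@ltr0n R) -(pmulr_rgt0 _ K0) (lt_le_trans T0).
  have : (0 < #|[set U : {set 'I_n} | #|U| == num_clauses d n 1]%SET|)%N.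
    by rewrite card_draws card_ord bin_gt0 ltnW // num_units_lt.
  move=> /card_gt0P[U]; rewrite finset.inE => cU.
  by apply/card_gt0P; exists (U, f); rewrite finset.inE /= cU.
suff avg : (\sum_(w in samples d n) (n - #|consequences w.1 w.2|)%N%:R) / n%:R
    / #|samples d n|%:R @[n --> \oo] --> 1 - t0.
  have h : (\sum_(w in samples d n) (n - #|consequences w.1 w.2|)%N%:R) / n%:R
      / #|samples d n|%:R / ((n - num_clauses d n 1)%:R / n%:R) @[n --> \oo]
      --> (1 - t0) / (1 - dcoef d 1).
    by apply: cvgM => //; apply: cvgV => //; exact: cvg_num_nonunits.
  apply: cvg_trans h; apply: near_eq_cvg; near=> n.
  have n0 : (0 < n)%N by near: n; exact: nbhs_infty_gt.
  have s0 : (0 < #|samples d n|)%N by near: n.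
  have m0 : (0 < n - num_clauses d n 1)%N by rewrite subn_gt0 num_units_lt.
  rewrite (sat_prob_samples (i0 := Ordinal n0)) //; set A := \sum_(_ in _) _.
  by field; rewrite !pnatr_eq0 -!lt0n n0 s0 m0.
apply/cvgrPdist_le => e e0; near=> n.
have n0 : 0 < n%:R :> R by rewrite ltr0n; near: n; exact: nbhs_infty_gt.
have s0 : 0 < #|samples d n|%:R :> R by rewrite ltr0n; near: n.
have mean : forall U : {set 'I_n}, #|U| = num_clauses d n 1 ->
    \sum_(f in proper_systems d n) `|#|consequences U f|%:R / n%:R - t0|
      <= e * #|proper_systems d n|%:R.
  by near: n; exact: mean_deviation.
have -> : 1 - t0 - (\sum_(w in samples d n) (n - #|consequences w.1 w.2|)%N%:R) / n%:R
    / #|samples d n|%:R = (\sum_(w in samples d n)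
      (#|consequences w.1 w.2|%:R / n%:R - t0)) / #|samples d n|%:R.
  rewrite -[LHS](mulfK (lt0r_neq0 s0)); congr (_ / _).
  rewrite mulrBl divfK ?lt0r_neq0 // mulr_natr -sumr_const mulr_suml -sumrB.
  apply: eq_bigr => w _; rewrite natrB; last by rewrite -[leqRHS]card_ord max_card.
  by field; exact: lt0r_neq0.
rewrite normf_div (ger0_norm (ltW s0)) ler_pdivrMr //.
apply: le_trans (ler_norm_sum _ _ _) _; rewrite mulr_natr -sumr_const !sum_samples.
apply: ler_sum => U /eqP cU; apply: le_trans (mean U cU) _.
by rewrite sumr_const mulr_natr.
Unshelve. all: by end_near. Qed.

End Averaging.

(** * The smallest root *)

Section Root.
Variables (R : realType) (k : nat) (d : k.-tuple R).
Local Open Scope classical_set_scope.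
Local Open Scope ring_scope.
Hypothesis hd1 : dcoef d 1 < 1.

Lemma root_funE t : root_fun d t = ln ((1 - t) / (1 - dcoef d 1)) + rate d t.
Proof.
rewrite /root_fun -[2%N]add0n big_addn subSS subn1 big_mkord.
by congr (_ + _); apply: eq_bigr => i _; rewrite addn2.
Qed.

(** [root_fun] is the logarithm of [(1 - t) / survival t], so its sign compares the two. *)
Lemma survivalE t : t < 1 -> survival d t = (1 - t) * expR (- root_fun d t).
Proof.
move=> t1; rewrite root_funE opprD expRD expRN lnK ?posrE; last first.
  by rewrite divr_gt0 // subr_gt0.
by rewrite invf_div /survival; field; rewrite gt_eqF ?subr_gt0.
Qed.

Lemma survival_lt t : t < 1 -> (survival d t < 1 - t) = (0 < root_fun d t).
Proof.
move=> t1; rewrite survivalE // gtr_pMr ?subr_gt0 // -expR0 ltr_expR.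
by rewrite oppr_lt0.
Qed.

Lemma survival_gt t : t < 1 -> (1 - t < survival d t) = (root_fun d t < 0).
Proof.
move=> t1; rewrite survivalE // ltr_pMr ?subr_gt0 // -expR0 ltr_expR.
by rewrite oppr_gt0.
Qed.

Lemma rate0 : rate d 0 = 0.
Proof. by rewrite /rate big1 // => i _; rewrite expr0n mulr0. Qed.

Lemma survival0 : survival d 0 = 1 - dcoef d 1.
Proof. by rewrite /survival rate0 oppr0 expR0 mulr1. Qed.

Lemma derivable_root_fun t : t < 1 -> derivable (root_fun d) t 1.
Proof.
move=> t1.
pose p : {poly R} := \sum_(i < k.-1) (dcoef d i.+2)%:P * 'X^(i.+1).
pose g : {poly R} := (1 - 'X) * ((1 - dcoef d 1)^-1)%:P.
have -> : root_fun d = (@ln R \o horner g) + horner p.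
  apply/funext => x; rewrite root_funE !fctE /comp /g !hornerE; congr (_ + _).
  by rewrite /p horner_sum; apply: eq_bigr => i _; rewrite !hornerE.
apply: derivableD; last exact: derivable_horner.
apply/derivable1_diffP/differentiable_comp.
  exact/derivable1_diffP/derivable_horner.
apply/derivable1_diffP; apply: ex_derive; apply: is_derive1_ln.
by rewrite /g !hornerE divr_gt0 // subr_gt0.
Qed.

Variable t0 : R.
Hypothesis ht0 : smallest_root d t0.

Lemma root_lt1 : t0 < 1. Proof. by case: ht0 => _ []. Qed.

(** At 0 the difference [1 - z - survival z] equals [d_1 > 0]; a change of sign before [t0] would
    give a smaller root. Unlike [root_fun], this difference is continuous everywhere. *)
Lemma root_fun_gt0 z : 0 < dcoef d 1 -> 0 <= z < t0 -> 0 < root_fun d z.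
Proof.
move=> d0 /andP[z0 zt]; have z1 := lt_trans zt root_lt1.
rewrite -survival_lt // ltNge; apply/negP => sz.
have cG : {within `[0, z], continuous (fun z => 1 - z - survival d z)}.
  apply: continuous_subspaceT => x; apply: cvgB; last exact: continuous_survival.
  by apply: cvgB; [exact: cvg_cst|exact: cvg_id].
have [|c] := IVT (v := 0) z0 cG.
  rewrite survival0 ge_min le_max; apply/andP; split; apply/orP; [right|left].
    by rewrite subr_le0.
  by rewrite subr0 opprB addrC subrK ltW.
rewrite in_itv /= => /andP[c0 cz] /eqP; rewrite subr_eq0 => /eqP Gc.
have c1 := le_lt_trans cz z1.
have rc : root_fun d c = 0.
  apply/eqP; rewrite eq_le !leNgt -survival_lt // -survival_gt // Gc ltxx //.
case: ht0 => _ _ /(_ c c0 (conj c1 rc)).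
by rewrite leNgt (le_lt_trans cz).
Qed.

Hypothesis hsimple : simple_root d t0.

(* Otherwise [t0] would be a local minimum of [root_fun d]. *)
Lemma root_fun_lt0 e : 0 < dcoef d 1 -> 0 < e ->
  exists2 z, t0 < z < t0 + e & root_fun d z < 0.
Proof.
move=> d0 e0; have t1 := root_lt1.
have [t_ge0 [_ rt] _] := ht0.
have t_gt0 : 0 < t0.
  (* A root at 0 would give [survival 0 = 1], against [1 - d_1]. *)
  rewrite lt_neqAle t_ge0 andbT; apply/eqP => t_eq0.
  have := rt; rewrite -t_eq0 => r0; have := survivalE (@ltr01 R).
  by rewrite survival0 r0 subr0 oppr0 expR0 mulr1; lra.
pose b := Num.min (t0 + e) 1.
have tb : t0 < b by rewrite /b lt_min t1 ltrDl e0.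
apply: contrapT => none.
have rge z : t0 < z -> z < b -> 0 <= root_fun d z.
  move=> tz; rewrite lt_min => /andP[ze z1]; rewrite leNgt; apply/negP => rz.
  by apply: none; exists z; rewrite ?tz.
have h : is_derive t0 1 (root_fun d) 0.
  (* On []0, b[] the function is nonnegative on both sides of [t0], where it vanishes. *)
  apply: (@derive1_at_min _ (root_fun d) 0 b).
  - exact/ltW/(lt_trans t_gt0).
  - move=> t; rewrite in_itv /= lt_min => /andP[_ /andP[_ t_lt1]].
    exact: derivable_root_fun.
  - by rewrite in_itv /= t_gt0.
  - move=> t; rewrite in_itv /= rt => /andP[t_0 tb'].
    case: (ltgtP t t0) => [tt0|t0t|->]; last by rewrite rt.
      by apply/ltW/root_fun_gt0 => //; rewrite ltW.
    exact: rge.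
by move: hsimple; rewrite /simple_root derive1E derive_val eqxx.
Qed.

End Root.

Local Open Scope classical_set_scope.
Local Open Scope ring_scope.

Theorem theorem1p1 (R : realType) (k : nat) (d : k.-tuple R) (t0 : R)
    (hk : (0 < k)%N)
    (hd : forall j : nat, (1 <= j <= k)%N -> 0 <= dcoef d j)
    (hd1 : dcoef d 1 < 1)
    (ht0 : smallest_root d t0)
    (hsimple : simple_root d t0) :
  sat_prob d n @[n --> \oo] --> (1 - t0) / (1 - dcoef d 1).
Proof.
have [t_ge0 [t_lt1 rt] tmin] := ht0.
apply: sat_prob_cvg => //; first by rewrite t_ge0 ltW.
have : 0 <= dcoef d 1 by rewrite hd // hk.
rewrite le_eqVlt => /orP[/eqP d0|d0]; last first.
  apply: consequences_concentration => // [z zt|e e0].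
    rewrite survival_lt ?(root_fun_gt0 hd1 ht0) //.
    by case/andP: zt => _ /lt_trans; apply.
  have m0 : 0 < Num.min e (1 - t0) by rewrite lt_min e0 subr_gt0.
  have [z /andP[tz zm] rz] := root_fun_lt0 hd1 ht0 hsimple d0 m0.
  move: zm; rewrite -ltrBlDl lt_min => /andP[ze z1].
  have z_lt1 : z < 1 by lra.
  by exists z; [rewrite tz /=; lra|rewrite survival_gt].
(* For [d_1 = 0] the point 0 is itself a root. *)
have t00 : t0 = 0.
  apply/le_anti; rewrite t_ge0 andbT; apply: tmin => //; split=> //.
  by rewrite root_funE rate0 -d0 !subr0 divr1 ln1 addr0.
(* Without unit clauses nothing is ever derived. *)
move=> e e0; near=> n => U; rewrite /num_clauses -d0 mul0r truncn0 => /finset.cards0_eq ->.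
apply: (@le_trans _ _ 0); last by rewrite mulr_ge0 // ltW.
rewrite lern0 finset.cards_eq0; apply/eqP/finset.setP => f.
rewrite finset.in_set0; apply/negbTE/negP => /setIdP[fs].
suff -> : consequences finset.set0 f = finset.set0.
  by rewrite finset.cards0 mul0r t00 subr0 normr0 leNgt e0.
apply/eqP; rewrite -finset.subset0; apply: consequences_min.
(* Bodies have at least one variable, so none lies in the empty set. *)
rewrite /stable_set finset.subUset fintype.subxx /=.
apply/fintype.subsetP => x /imsetP[s]; rewrite finset.inE finset.subset0 => /eqP fs0.
by move: fs; rewrite finset.inE => /forallP/(_ s); rewrite fs0 finset.cards0.
Unshelve. all: by end_near. Qed.
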